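(* Let $n\geq 5$ be an integer and regard $\tilde{J}'=\tilde{J}(n-1,2)=(1^2,0^{n-3},0)^{P'}$ as a subset of the $(n-1)$-dimensional Euclidean space $H=\{(x_1,\dots,x_n)\in\mathbb{R}^n:\sum_i x_i=2\}\simeq\mathbb{R}^{n-1}$. Define (with matching choices of upper or lower signs within each set) $$X_1^{\pm}=\left\{\left(\left(\tfrac{2n\pm2\sqrt n}{n(n-1)}\right)^{n-1},\ \mp\tfrac{2\sqrt n}{n}\right)\right\},\qquad X_2^{\pm}=\left\{\left(\left(\tfrac{2n\pm\sqrt{2n^2+2n}}{n(n-1)}\right)^{n-1},\ \mp\tfrac{\sqrt{2n^2+2n}}{n}\right)\right\},$$ $$X_3^{\pm}=\left(\tfrac{n\pm1}{n-1},\ \left(\tfrac{1\pm1}{n-1}\right)^{n-2},\ \mp1\right)^{P'},$$ and, when $n\leq 10$, $$X_4^{\pm}=\left(\left(\tfrac{3n\pm\sqrt{10n-n^2}}{n(n-1)}\right)^{n-2},\ \tfrac{-n^2+4n\pm\sqrt{10n-n^2}}{n(n-1)},\ \mp\tfrac{\sqrt{10n-n^2}}{n}\right)^{P'}$$ (so $X_4^+=X_4^-$ when $n=10$); for $n>10$ the sets $X_4^\pm$ are absent. (1) A vector $x\in H\setminus\tilde{J}'$ can be added to $\tilde{J}'$ while maintaining two-distance (i.e. $\tilde{J}'\cup\{x\}$ is a two-distance set) if and only if $x$ belongs to one of the sets $X_i^{\pm}$. Moreover, for each of these sets, all of its vectors can be added simultaneously: $\tilde{J}'\cup X_i^{+}$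 and $\tilde{J}'\cup X_i^{-}$ are two-distance sets. (2) The combinations (unions) $U$ of at least two distinct sets among the $X_i^{\pm}$ for which $\tilde{J}'\cup U$ is a two-distance set are exactly the following ones and the sub-unions of them (the total number of vectors of $\tilde{J}'\cup U$ is given in brackets): - $n=5$: $X_1^+\cup X_1^-$ $[8]$; - $n=6$: $X_1^+\cup X_4^-$ $[16]$ and $X_1^-\cup X_4^+$ $[16]$; - $n=7$: $X_4^+\cup X_4^-$ $[27]$; - $n=8$: $X_2^+\cup X_4^+$ $[29]$ and $X_2^-\cup X_4^-$ $[29]$; - $n=9$: $X_1^+\cup X_1^-$ $[30]$, $X_1^+\cup X_3^-\cup X_4^-$ $[45]$ and $X_1^-\cup X_3^+\cup X_4^+$ $[45]$; - $n=17$: $X_1^+\cup X_2^-$ $[122]$ and $X_1^-\cup X_2^+$ $[122]$.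
   Context: Notation: inside parentheses, exponents are multiplicities of coordinates, not powers. For a vector of length $n$ written in this way, the exponent $P'$ outside the parentheses denotes the set of all vectors obtained from it by permuting the first $n-1$ coordinates, the last coordinate being fixed. Thus $\tilde{J}(n-1,2)=(1^2,0^{n-3},0)^{P'}$ is the set of all $0/1$ vectors of length $n$ with exactly two ones and last coordinate $0$ (a representation of the Johnson graph $J(n-1,2)$ in $\mathbb{R}^{n-1}$). A finite subset of a Euclidean space is a two-distance set if exactly two distinct values occur as Euclidean distances between distinct points of it. *)

(* Defs.v *)
From HB Require Import structures.
From mathcomp Require Import all_boot all_order all_algebra all_fingroup.
From mathcomp Require Import boolp classical_sets functions cardinality reals.

Set Implicit Arguments.
Unset Strict Implicit.
Unset Printing Implicit Defensive.

Import Order.TTheory GRing.Theory Num.Theory.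
Local Open Scope classical_set_scope.
Local Open Scope ring_scope.

(* The norm MathComp-Analysis puts on 'rV[R]_n is the sup norm. *)
Definition edist (R : realType) (n : nat) (x y : 'rV[R]_n) : R :=
  Num.sqrt (\sum_(i < n) (x 0 i - y 0 i) ^+ 2).

Definition distances (R : realType) (n : nat) (A : set 'rV[R]_n) : set R :=
  [set d | exists x y, [/\ A x, A y, x <> y & d = edist x y]].

Definition two_distance_set (R : realType) (n : nat) (A : set 'rV[R]_n) : Prop :=
  finite_set A /\ (distances A #= `I_2)%card.

Definition hyperplane2 (R : realType) (n : nat) : set 'rV[R]_n :=
  [set x | \sum_(i < n) x 0 i = 2].

Arguments hyperplane2 : clear implicits.

(* nseq k a ++ ... renders the multiplicity notation (a^k, ...);
   coordinates beyond size s, if any, are 0. *)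
Definition vec_of (R : realType) (n : nat) (s : seq R) : 'rV[R]_n :=
  \row_(j < n) s`_j.

(* v^{P'}: the coordinate with j.+1 = n is the last one. *)
Definition orbitP' (R : realType) (n : nat) (v : 'rV[R]_n) : set 'rV[R]_n :=
  [set x | exists s : 'S_n,
     (forall j : 'I_n, j.+1 = n -> s j = j) /\ x = col_perm s v].

Definition Jt (R : realType) (n : nat) : set 'rV[R]_n :=
  orbitP' (vec_of n (nseq 2 1 ++ nseq (n - 3) 0 ++ [:: 0])).

Arguments Jt : clear implicits.

(* In X1, ..., X4 the parameter e is 1 for the upper signs and -1 for the
   lower ones. *)
Definition X1 (R : realType) (n : nat) (e : R) : set 'rV[R]_n :=
  let N : R := n%:R in
  [set vec_of n
     (nseq (n - 1) ((2 * N + e * (2 * Num.sqrt N)) / (N * (N - 1)))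
      ++ [:: - e * (2 * Num.sqrt N / N)])].

Definition X2 (R : realType) (n : nat) (e : R) : set 'rV[R]_n :=
  let N : R := n%:R in
  let r := Num.sqrt (2 * N ^+ 2 + 2 * N) in
  [set vec_of n
     (nseq (n - 1) ((2 * N + e * r) / (N * (N - 1))) ++ [:: - e * (r / N)])].

Definition X3 (R : realType) (n : nat) (e : R) : set 'rV[R]_n :=
  let N : R := n%:R in
  orbitP' (vec_of n
    ([:: (N + e) / (N - 1)] ++ nseq (n - 2) ((1 + e) / (N - 1)) ++ [:: - e])).

Definition X4 (R : realType) (n : nat) (e : R) : set 'rV[R]_n :=
  let N : R := n%:R in
  let r := Num.sqrt (10 * N - N ^+ 2) in
  orbitP' (vec_of n
    (nseq (n - 2) ((3 * N + e * r) / (N * (N - 1)))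
     ++ [:: (- N ^+ 2 + 4 * N + e * r) / (N * (N - 1)); - e * (r / N)])).

Arguments X1 {R} n e _.
Arguments X2 {R} n e _.
Arguments X3 {R} n e _.
Arguments X4 {R} n e _.

Definition Xsets (R : realType) (n : nat) : set (set 'rV[R]_n) :=
  [set A | exists2 e : R, e = 1 \/ e = -1 &
     [\/ A = X1 n e, A = X2 n e, A = X3 n e | (n <= 10)%N /\ A = X4 n e]].

Arguments Xsets : clear implicits.

(* Each entry is a collection of sets together with the number of vectors in
   the union of Jt with these sets. *)
Definition maximal_combinations (R : realType) (n : nat) :
    set (set (set 'rV[R]_n) * nat) :=
  match n with
  | 5 => [set ([set X1 n 1; X1 n (-1)], 8%N)]
  | 6 => [set ([set X1 n 1; X4 n (-1)], 16%N);
              ([set X1 n (-1); X4 n 1], 16%N)]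
  | 7 => [set ([set X4 n 1; X4 n (-1)], 27%N)]
  | 8 => [set ([set X2 n 1; X4 n 1], 29%N);
              ([set X2 n (-1); X4 n (-1)], 29%N)]
  | 9 => [set ([set X1 n 1; X1 n (-1)], 30%N);
              ([set X1 n 1; X3 n (-1); X4 n (-1)], 45%N);
              ([set X1 n (-1); X3 n 1; X4 n 1], 45%N)]
  | 17 => [set ([set X1 n 1; X2 n (-1)], 122%N);
               ([set X1 n (-1); X2 n 1], 122%N)]
  | _ => set0
  end.

Arguments maximal_combinations : clear implicits.

(* Main.v *)
Require Import Defs.
From HB Require Import structures.
From mathcomp Require Import all_boot all_order all_algebra all_fingroup.
From mathcomp Require Import boolp classical_sets functions cardinality reals.
From mathcomp Require Import ring lra zify.

Set Implicit Arguments.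
Unset Strict Implicit.
Unset Printing Implicit Defensive.

Import Order.TTheory GRing.Theory Num.Theory.
Local Open Scope classical_set_scope.
Local Open Scope ring_scope.

(* Write n = m + 1. The Johnson graph already realizes exactly the squared
   distances 2 and 4, so a set can be added iff all new squared distances are 2
   or 4. If x can be added, then x_i + x_j takes at most two values, s and
   s - 1, over the pairs i <> j of the first m >= 4 coordinates; hence these
   coordinates are equal except for at most one, which exceeds the others by
   1 or - 1. The distances to the Johnson graph then determine n times the
   square of the last coordinate, which gives the four families. The squared
   distance between a point of X_k and one of X_l is, up to the factor m, an
   affine function of n and of u = sqrt (q_k q_l), where q_k and q_l are affine
   in n; equating it to 2 m or 4 m and eliminating u gives an equation of degree
   at most two for n, whose integral roots n >= 5 give the compatible pairs. The
   allowed combinations are the cliques of this compatibility relation. *)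

(** * Vectors with the last coordinate split off *)

Definition sqd (R : realType) (n : nat) (x y : 'rV[R]_n) : R :=
  \sum_(i < n) (x 0 i - y 0 i) ^+ 2.

(** The last coordinate, which P' fixes, is kept apart from the first m, on which all permutations
    act. *)
Definition pt (R : realType) (m : nat) (z : R) (f : 'I_m -> R) : 'rV[R]_m.+1 :=
  \row_j (if unlift ord_max j is Some i then f i else z).

Lemma pt_last (R : realType) (m : nat) (z : R) (f : 'I_m -> R) :
  pt z f 0 ord_max = z.
Proof. by rewrite mxE unlift_none. Qed.

Lemma pt_lift (R : realType) (m : nat) (z : R) (f : 'I_m -> R) (i : 'I_m) :
  pt z f 0 (lift ord_max i) = f i.
Proof. by rewrite mxE liftK. Qed.

Lemma pt_eta (R : realType) (m : nat) (x : 'rV[R]_m.+1) :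
  x = pt (x 0 ord_max) (fun i => x 0 (lift ord_max i)).
Proof. by apply/rowP => j; rewrite mxE; case: unliftP => [i|] ->. Qed.

Lemma eq_pt (R : realType) (m : nat) (z z' : R) (f f' : 'I_m -> R) :
  z = z' -> f =1 f' -> pt z f = pt z' f'.
Proof. by move=> -> ff; apply/rowP => j; rewrite !mxE; case: unlift. Qed.

Lemma hyperplane2_pt (R : realType) (m : nat) (z : R) (f : 'I_m -> R) :
  hyperplane2 R m.+1 (pt z f) <-> z + \sum_i f i = 2.
Proof.
rewrite /hyperplane2/= (bigD1_ord ord_max)//= pt_last.
by under eq_bigr do rewrite pt_lift.
Qed.

Lemma sqd_pt (R : realType) (m : nat) (z z' : R) (f f' : 'I_m -> R) :
  sqd (pt z f) (pt z' f') = (z - z') ^+ 2 + \sum_i (f i - f' i) ^+ 2.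
Proof.
rewrite /sqd (bigD1_ord ord_max)//= !pt_last.
by under eq_bigr do rewrite !pt_lift.
Qed.

Lemma sqd_ge0 (R : realType) (n : nat) (x y : 'rV[R]_n) : 0 <= sqd x y.
Proof. by apply: sumr_ge0 => i _; exact: sqr_ge0. Qed.

Lemma sqdC (R : realType) (n : nat) (x y : 'rV[R]_n) : sqd x y = sqd y x.
Proof. by apply: eq_bigr => i _; rewrite -sqrrN opprB. Qed.

Lemma sqdxx (R : realType) (n : nat) (x : 'rV[R]_n) : sqd x x = 0.
Proof. by rewrite /sqd big1// => i _; rewrite subrr expr0n. Qed.

(** A permutation fixing the last index maps the other indices among themselves, so it restricts to
    ['I_m]; conversely [lift_perm] extends a permutation of ['I_m]. *)
Lemma orbitP'_pt (R : realType) (m : nat) (z : R) (f : 'I_m -> R) :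
  orbitP' (pt z f) = [set x | exists s : 'S_m, x = pt z (f \o s)].
Proof.
apply/seteqP; split => [x [s [sfix ->]]|x [s ->]] /=.
- have smax : s ord_max = ord_max by exact: sfix.
  have sl (i : 'I_m) : exists j : 'I_m, s (lift ord_max i) = lift ord_max j.
    have : s (lift ord_max i) != ord_max.
      by rewrite -{2}smax (inj_eq perm_inj) eq_sym neq_lift.
    by rewrite eq_sym; case/unlift_some => j -> _; exists j.
  have [g gP] := choice sl.
  have g_inj : injective g.
    move=> i j gij; apply: (@lift_inj _ ord_max); apply: (@perm_inj _ s).
    by rewrite !gP gij.
  exists (perm g_inj); apply/rowP => j.
  rewrite 2!mxE [in RHS]mxE; case: (unliftP ord_max j) => [i|] ->.
    by rewrite gP liftK /= permE.
  by rewrite smax unlift_none.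
- exists (lift_perm ord_max ord_max s); split.
    move=> j jm; have -> : j = ord_max by apply: val_inj => /=; case: jm.
    by rewrite lift_perm_id.
  apply/rowP => j; rewrite 3!mxE; case: (unliftP ord_max j) => [i|] ->.
    by rewrite lift_perm_lift liftK.
  by rewrite lift_perm_id unlift_none.
Qed.

(** * The Johnson graph as indicator vectors of pairs *)

Definition jvec (R : realType) (m : nat) (A : {set 'I_m}) : 'rV[R]_m.+1 :=
  pt 0 (fun i => (i \in A)%:R).
Arguments jvec : clear implicits.
Arguments jvec R {m} A.

Lemma vec_of_pt (R : realType) (m : nat) (s : seq R) :
  vec_of m.+1 s = pt s`_m (fun i => s`_i).
Proof.
apply/rowP => j; rewrite !mxE; case: (unliftP ord_max j) => [i|] -> //.
by rewrite lift_max.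
Qed.

Lemma Jt_jvec (R : realType) (m : nat) : (2 <= m)%N ->
  Jt R m.+1 = [set x | exists2 A : {set 'I_m}, #|A| = 2%N & x = jvec R A].
Proof.
move=> m2; have m0 : (0 < m)%N by exact: leq_trans m2.
pose o0 := Ordinal m0; pose o1 := Ordinal m2.
have -> : Jt R m.+1 =
    orbitP' (pt 0 (fun i : 'I_m => (i \in [set o0; o1]%SET)%:R)).
  (* After the two leading ones every entry is 0, and so is the default of [nth]; the exact length
     of the block of zeros is therefore irrelevant. *)
  rewrite /Jt vec_of_pt; congr (orbitP' _); apply: eq_pt.
    case: m m2 {m0 o0 o1} => [|[|m]]// _ /=.
    rewrite nth_cat size_nseq nth_nseq !if_same.
    by case: ifP => // _; case: (_ - _)%N => [|[]].
  move=> [[|[|i]] lt_i_m]; rewrite !inE -!val_eqE //=.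
  rewrite nth_cat size_nseq nth_nseq !if_same.
  by case: ifP => // _; case: (_ - _)%N => [|[]].
rewrite orbitP'_pt; apply/seteqP; split => [x [s ->]|x [A]] /=.
  exists (s @^-1: [set o0; o1])%SET.
    rewrite on_card_preimset ?cards2//.
    by apply: onW_bij; apply: injF_bij; exact: perm_inj.
  by apply: eq_pt => // i /=; rewrite !inE.
move=> A2 ->; have /cards2P[a [b [ab ->]]] : #|A| == 2%N by rewrite A2.
pose b' := tperm a o0 b.
have b'0 : b' != o0.
  by rewrite -[o0](tpermL a) (inj_eq perm_inj) eq_sym.
(* The first transposition sends a to [o0] and b to b'; the second sends b' to [o1] and fixes [o0],
   since b' differs from [o0]. *)
exists (tperm a o0 * tperm b' o1)%g; apply: eq_pt => // i /=.
have sa : (tperm a o0 * tperm b' o1)%g a = o0.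
  by rewrite permM tpermL tpermD// eq_sym.
have sb : (tperm a o0 * tperm b' o1)%g b = o1.
  by rewrite permM -/b' tpermL.
move: (_ * _)%g sa sb => s sa sb.
by rewrite !inE -[in RHS]sa -[in RHS]sb !(inj_eq perm_inj).
Qed.

(** * Points with one exceptional coordinate *)

Definition base (R : realType) (m : nat) (t v : R) : R := (2 - v + t) / m%:R.

(* A point of the hyperplane whose first m coordinates are constant except for
   an excess v in position i; its last coordinate is - t. *)
Definition spike (R : realType) (m : nat) (t v : R) (i : 'I_m) : 'rV[R]_m.+1 :=
  pt (- t) (fun j => base m t v + v * (j == i)%:R).

Lemma sum_delta (R : realType) (m : nat) (i : 'I_m) (F : 'I_m -> R) :
  \sum_j F j * (j == i)%:R = F i.
Proof.
rewrite (bigD1 i)//= eqxx mulr1 big1 ?addr0// => j /negbTE ->.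
by rewrite mulr0.
Qed.

Lemma spike_hyperplane (R : realType) (m : nat) (t v : R) (i : 'I_m) :
  (0 < m)%N -> hyperplane2 R m.+1 (spike t v i).
Proof.
move=> m0; apply/hyperplane2_pt; rewrite big_split/= sum_delta.
have M0 : m%:R != 0 :> R by rewrite pnatr_eq0 -lt0n.
by rewrite sumr_const card_ord /base -[_ *+ m]mulr_natr; field.
Qed.

Lemma sum_sq_shift (R : realType) (m : nat) (a : R) (g : 'I_m -> R) :
  \sum_i (a + g i) ^+ 2 = m%:R * a ^+ 2 + 2 * a * \sum_i g i + \sum_i g i ^+ 2.
Proof.
under eq_bigr do rewrite sqrrD.
rewrite !big_split/= sumr_const card_ord -[_ *+ m]mulr_natl -mulr_sumr.
by ring.
Qed.

Lemma sum_sq_delta (R : realType) (m : nat) (v : R) (i : 'I_m) (g : 'I_m -> R) :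
  \sum_j (v * (j == i)%:R + g j) ^+ 2 =
  v ^+ 2 + 2 * v * g i + \sum_j g j ^+ 2.
Proof.
rewrite (bigD1 i)//= [in RHS](bigD1 i)//= eqxx mulr1.
under eq_bigr => j /negbTE -> do rewrite mulr0 add0r.
by ring.
Qed.

(** The factor m clears the denominator of [base]. Two spikes differ, on the first m coordinates, by
    a constant plus two multiples of deltas, whose cross term survives only when i = i'. *)
Lemma sqd_spike (R : realType) (m : nat) (t v t' v' : R) (i i' : 'I_m) :
  m%:R * sqd (spike t v i) (spike t' v' i') =
  m.+1%:R * (t - t') ^+ 2 +
  (m%:R * (v ^+ 2 + v' ^+ 2 - 2 * v * v' * (i == i')%:R) - (v - v') ^+ 2).
Proof.
have m0 : m%:R != 0 :> R.
  by rewrite pnatr_eq0 -lt0n (leq_ltn_trans _ (ltn_ord i)).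
rewrite sqd_pt.
under eq_bigr do rewrite opprD addrACA.
rewrite sum_sq_shift sumrB !sum_delta sum_sq_delta.
have -> : \sum_j (- (v' * (j == i')%:R)) ^+ 2 = v' ^+ 2.
  have := sum_sq_delta v' i' (fun _ => 0).
  rewrite [X in _ + X]big1 => [|j _]; last by rewrite expr0n.
  rewrite mulr0 !addr0 => <-.
  by apply: eq_bigr => j _; rewrite sqrrN addr0.
rewrite /base -natr1; set b := (i == i')%:R.
by field.
Qed.

Lemma sqd_spike_jvec (R : realType) (m : nat) (t v : R) (i : 'I_m)
    (A : {set 'I_m}) : #|A| = 2%N ->
  m%:R * sqd (spike t v i) (jvec R A) =
  m.+1%:R * t ^+ 2 + 2 * (m%:R - 2) + v ^+ 2 * (m%:R - 1) + 4 * v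
  - 2 * v * m%:R * (i \in A)%:R.
Proof.
move=> A2; have m0 : m%:R != 0 :> R.
  by rewrite pnatr_eq0 -lt0n (leq_ltn_trans _ (ltn_ord i)).
have sA : \sum_j (j \in A)%:R = 2 :> R.
  by rewrite -natr_sum -A2 -sum1_card [in RHS]big_mkcond.
rewrite sqd_pt subr0.
under eq_bigr do rewrite -addrA.
rewrite sum_sq_shift sumrB sum_delta sA sum_sq_delta.
have -> : \sum_j (- (j \in A)%:R) ^+ 2 = 2 :> R.
  rewrite -sA; apply: eq_bigr => j _.
  by rewrite sqrrN -natrX -mulnn mulnb andbb.
rewrite /base -natr1; set b := (i \in A)%:R.
by field.
Qed.

(** * The two-distance criterion around the Johnson graph *)

Lemma card_uniq_seq (T : eqType) (s : seq T) :
  uniq s -> ([set` s] #= `I_(size s))%card.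
Proof.
case: s => [|x0 s'] us; first by rewrite set_nil II0; exact: card_eq00.
set s := x0 :: s' in us *.
have <- : nth x0 s @` `I_(size s) = [set` s].
  apply/seteqP; split => [_ [i ilt <-]|x xs]; first exact: mem_nth.
  by exists (index x s); [rewrite /mkset index_mem | rewrite nth_index].
apply: inj_card_eq => i j; rewrite !inE => iI jI ij.
by apply/eqP; rewrite -(nth_uniq x0 iI jI us) ij.
Qed.

Lemma card2_mem (T : eqType) (D : set T) (a b c : T) :
  (D #= `I_2)%card -> D a -> D b -> a != b -> D c -> c = a \/ c = b.
Proof.
move=> D2 Da Db ab Dc.
have [->|ca] := eqVneq c a; first by left.
have [->|cb] := eqVneq c b; first by right.
have u : uniq [:: a; b; c] by rewrite /= !inE negb_or ab !(eq_sym _ c) ca cb.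
have : ([set` [:: a; b; c]] #<= D)%card.
  by apply: subset_card_le => x /=; rewrite !inE => /or3P[] /eqP ->.
by rewrite (card_le_eql (card_uniq_seq u)) (card_le_eqr D2) card_le_II.
Qed.

Lemma sqd_jvec (R : realType) (m : nat) (A B : {set 'I_m}) :
  #|A| = 2%N -> #|B| = 2%N ->
  sqd (jvec R A) (jvec R B) = 4 - 2 * #|A :&: B|%:R.
Proof.
move=> A2 B2.
have s (C : {set 'I_m}) : \sum_j (j \in C)%:R = #|C|%:R :> R.
  by rewrite -natr_sum -sum1_card [in RHS]big_mkcond.
rewrite sqd_pt subr0 expr0n add0r -s mulr_sumr.
(* Splitting 4 = |A| + |B| over the coordinates reduces the claim to (a - b)^2 = a + b - 2 a b for
   bits. *)
have -> : 4 = \sum_(j < m) ((j \in A)%:R + (j \in B)%:R) :> R.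
  by rewrite big_split/= !s A2 B2 -natrD.
rewrite -sumrB; apply: eq_bigr => j _; rewrite inE.
by case: (j \in A); case: (j \in B) => /=; ring.
Qed.

Lemma jvec_inj (R : realType) (m : nat) : injective (@jvec R m).
Proof.
move=> A B AB; apply/setP => i.
have /eqP := congr1 (fun x : 'rV_m.+1 => x 0 (lift ord_max i)) AB.
by rewrite !pt_lift eqr_nat; do 2!case: (_ \in _).
Qed.

Lemma sqd_jvec_neq (R : realType) (m : nat) (A B : {set 'I_m}) :
  #|A| = 2%N -> #|B| = 2%N -> A != B ->
  sqd (jvec R A) (jvec R B) = 2 \/ sqd (jvec R A) (jvec R B) = 4.
Proof.
move=> A2 B2 AB; rewrite sqd_jvec//.
have : (#|A :&: B| < 2)%N.
  rewrite ltn_neqAle -{2}A2 subset_leq_card ?subsetIl// andbT.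
  apply: contraNneq AB => AB2.
  have /eqP <- : A :&: B == A by rewrite eqEcard subsetIl A2 AB2.
  by rewrite eqEcard subsetIr B2 AB2.
by case: #|_| => [|[|]]// _; [right|left]; ring.
Qed.

Lemma edist_sqd (R : realType) (n : nat) (x y : 'rV[R]_n) :
  edist x y = Num.sqrt (sqd x y).
Proof. by []. Qed.

Lemma Jt_finite (R : realType) (m : nat) : (2 <= m)%N -> finite_set (Jt R m.+1).
Proof.
move=> m2; rewrite Jt_jvec//.
apply: (@sub_finite_set _ _ [set` map (jvec R) (enum {set 'I_m})]).
  by move=> x [A _ ->] /=; rewrite map_f// mem_enum.
exact: finite_seq.
Qed.

Definition sq24 (R : realType) (n : nat) (x y : 'rV[R]_n) : Prop :=
  sqd x y = 2 \/ sqd x y = 4.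

(** Since m >= 4, there are pairs meeting in one point and disjoint pairs, so the distances sqrt 2
    and sqrt 4 both occur already and leave room for no third one. [S] may overlap the Johnson
    graph, hence the guard [x <> jvec R A]. *)
Lemma two_distance_Jt (R : realType) (m : nat) (S : set 'rV[R]_m.+1) :
  (4 <= m)%N -> finite_set S ->
  two_distance_set (Jt R m.+1 `|` S) <->
  (forall (A : {set 'I_m}) x, #|A| = 2%N -> S x -> x <> jvec R A ->
     sq24 x (jvec R A)) /\
  (forall x y, S x -> S y -> x <> y -> sq24 x y).
Proof.
move=> m4 finS; have m2 : (2 <= m)%N by exact: leq_trans m4.
have fin : finite_set (Jt R m.+1 `|` S).
  by rewrite finite_setU; split => //; exact: Jt_finite.
pose o k (km : (k < 4)%N) : 'I_m := Ordinal (leq_trans km m4).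
(* [A0] meets [A1] in one point and is disjoint from [A2]; these realize the squared distances 2 and
   4. *)
pose A0 : {set 'I_m} := [set o 0 isT; o 1 isT]%SET.
pose A1 : {set 'I_m} := [set o 0 isT; o 2 isT]%SET.
pose A2 : {set 'I_m} := [set o 2 isT; o 3 isT]%SET.
have cA0 : #|A0| = 2%N by rewrite cards2.
have cA1 : #|A1| = 2%N by rewrite cards2.
have cA2 : #|A2| = 2%N by rewrite cards2.
have d01 : sqd (jvec R A0) (jvec R A1) = 2.
  rewrite sqd_jvec//; have -> : A0 :&: A1 = [set o 0 isT]%SET.
    by apply/setP => i; rewrite !inE -!val_eqE/=; case: i => [[|[|[|]]]].
  by rewrite cards1; ring.
have d02 : sqd (jvec R A0) (jvec R A2) = 4.
  rewrite sqd_jvec//; have -> : A0 :&: A2 = finset.set0.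
    by apply/setP => i; rewrite !inE -!val_eqE/=; case: i => [[|[|[|]]]].
  by rewrite cards0; ring.
have sqrtN : Num.sqrt (2 : R) != Num.sqrt 4.
  by rewrite eqr_sqrt ?ler0n // eqr_nat.
pose D := distances (Jt R m.+1 `|` S).
have JtA (A : {set 'I_m}) : #|A| = 2%N -> Jt R m.+1 (jvec R A).
  by move=> cA; rewrite Jt_jvec//; exists A.
have D2 : D (Num.sqrt 2).
  exists (jvec R A0), (jvec R A1); split; rewrite ?edist_sqd ?d01//;
    try by left; exact: JtA.
  by move=> e; move: d01; rewrite e sqdxx; lra.
have D4 : D (Num.sqrt 4).
  exists (jvec R A0), (jvec R A2); split; rewrite ?edist_sqd ?d02//;
    try by left; exact: JtA.
  by move=> e; move: d02; rewrite e sqdxx; lra.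
split.
- move=> [_ card2].
  have P x y : (Jt R m.+1 `|` S) x -> (Jt R m.+1 `|` S) y -> x <> y -> sq24 x y.
    move=> Sx Sy xy.
    have [] : edist x y = Num.sqrt 2 \/ edist x y = Num.sqrt 4.
    - by apply: (card2_mem card2 D2 D4 sqrtN); exists x, y.
    - by move/eqP; rewrite edist_sqd eqr_sqrt ?sqd_ge0// => /eqP; left.
    - by move/eqP; rewrite edist_sqd eqr_sqrt ?sqd_ge0// => /eqP; right.
  split => [A x cA Sx|x y Sx Sy]; apply: P; try by right.
  by left; exact: JtA.
- move=> [PJ PS]; split => //.
  suff -> : distances (Jt R m.+1 `|` S) = [set` [:: Num.sqrt 2; Num.sqrt 4]].
    by apply: card_uniq_seq; rewrite /= inE sqrtN.
  apply/seteqP; split; last first.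
    by move=> d /=; rewrite !inE => /orP[] /eqP ->.
  move=> _ [x [y [Sx Sy xy ->]]].
  suff : sq24 x y.
    by rewrite edist_sqd => -[] -> /=; rewrite !inE eqxx ?orbT.
  move: Sx Sy xy; rewrite /setU /= Jt_jvec//.
  move=> [[A cA ->]|Sx] [[B cB ->]|Sy] xy.
  + by apply: sqd_jvec_neq => //; apply/eqP => AB; apply: xy; rewrite AB.
  + by rewrite /sq24 sqdC; apply: PJ => // /esym.
  + exact: PJ.
  + exact: PS.
Qed.

(** * A uniform description of the four families *)

(* (k, b) stands for X_(k+1) with the upper signs if b is false and the lower
   ones if b is true. *)
Definition code := (nat * bool)%type.

Definition sgn (R : realType) (b : bool) : R := if b then -1 else 1.
Arguments sgn : clear implicits.

Definition Xs (R : realType) (n : nat) (c : code) : set 'rV[R]_n :=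
  match c.1 with
  | 0 => X1 n (sgn R c.2)
  | 1 => X2 n (sgn R c.2)
  | 2 => X3 n (sgn R c.2)
  | _ => X4 n (sgn R c.2)
  end.
Arguments Xs : clear implicits.

Definition valid (n : nat) (c : code) : bool :=
  (c.1 < 3)%N || (c.1 == 3%N) && (n <= 10)%N.

(* The last coordinate of a point of Xs R n (k, b) is - sgn R b * tau R n k,
   and q R n k is n times its square. *)
Definition tau (R : realType) (n k : nat) : R :=
  let N : R := n%:R in
  match k with
  | 0 => 2 * Num.sqrt N / N
  | 1 => Num.sqrt (2 * N ^+ 2 + 2 * N) / N
  | 2 => 1
  | _ => Num.sqrt (10 * N - N ^+ 2) / N
  end.
Arguments tau : clear implicits.

Definition q (R : realType) (n k : nat) : R :=
  let N : R := n%:R in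
  match k with 0 => 4 | 1 => 2 * N + 2 | 2 => N | _ => 10 - N end.
Arguments q : clear implicits.

(** How far the exceptional one of the first n - 1 coordinates lies above the others in X_(k+1); for
    [X1] and [X2] there is no exceptional one. *)
Definition excess (R : realType) (k : nat) : R :=
  match k with 0 | 1 => 0 | 2 => 1 | _ => -1 end.
Arguments excess : clear implicits.

Lemma XsetsP (R : realType) (n : nat) (A : set 'rV[R]_n) :
  Xsets R n A <-> exists2 c, valid n c & A = Xs R n c.
Proof.
split.
- case=> e [] -> [->|->|->|[n10 ->]].
  + by exists (0%N, false).
  + by exists (1%N, false).
  + by exists (2%N, false).
  + by exists (3%N, false).
  + by exists (0%N, true).
  + by exists (1%N, true).
  + by exists (2%N, true).
  + by exists (3%N, true).
- case=> -[k b]; rewrite /valid /Xs /= => kn ->; exists (sgn R b).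
    by case: b; [right|left].
  case: k kn => [|[|[|[|k]]]]//= n10;
    by [exact: Or41|exact: Or42|exact: Or43|exact: Or44].
Qed.

Lemma tau_ge0 (R : realType) (n k : nat) : 0 <= tau R n k.
Proof.
by case: k => [|[|[|k]]] /=; rewrite ?ler01// divr_ge0 ?mulr_ge0 ?sqrtr_ge0.
Qed.

(** Validity matters for [X4]: the square root of a negative number is 0 by convention, and n <= 10
    makes the radicand 10 n - n^2 nonnegative. *)
Lemma tau_sq (R : realType) (n : nat) (c : code) :
  (0 < n)%N -> valid n c -> n%:R * tau R n c.1 ^+ 2 = q R n c.1.
Proof.
move=> n0; have N0 : n%:R != 0 :> R by rewrite pnatr_eq0 -lt0n.
have Nge0 : 0 <= n%:R :> R by exact: ler0n.
case: c => -[|[|[|[|k]]]] b; rewrite /valid //=.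
- by move=> _; rewrite exprMn exprVn exprMn sqr_sqrtr//; field.
- move=> _; rewrite exprMn exprVn sqr_sqrtr; first by field.
  by rewrite addr_ge0 ?mulr_ge0 ?exprn_ge0.
- by move=> _; rewrite expr1n mulr1.
- move=> n10; rewrite exprMn exprVn sqr_sqrtr; first by field.
  have : n%:R <= 10 :> R by rewrite ler_nat.
  by move=> N10; nra.
Qed.

Lemma orbitP'_spike (R : realType) (m : nat) (t v : R) (i : 'I_m) :
  orbitP' (spike t v i) = range (spike t v).
Proof.
rewrite orbitP'_pt; apply/seteqP; split => [x [s ->]|x [j _ <-]] /=.
  exists ((s^-1)%g i) => //; apply: eq_pt => // j /=.
  by rewrite -(inj_eq (@perm_inj _ s)) permKV.
exists (tperm i j); apply: eq_pt => // k /=.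
by rewrite -{2}(tpermR i j) (inj_eq perm_inj).
Qed.

Lemma range_spike0 (R : realType) (m : nat) (t : R) (i : 'I_m) :
  range (spike t (0 : R)) = [set spike t 0 i].
Proof.
apply/seteqP; split => [x [j _ <-]|x ->] /=; last by exists i.
by apply: eq_pt => // k; rewrite !mul0r.
Qed.

(** Each family is the orbit of one spike. The exceptional coordinate is written first in [X3] and
    last among the permuted ones in [X4], whence [ord0] and [ord_max]; with excess 0 the position is
    immaterial and the range is one point. *)
Lemma Xs_range (R : realType) (m : nat) (c : code) :
  (4 <= m)%N -> (c.1 < 4)%N ->
  Xs R m.+1 c =
  range (spike (sgn R c.2 * tau R m.+1 c.1) (excess R c.1) : 'I_m -> _).
Proof.
case: m => // m m4; case: c => k b; rewrite /Xs /=; move: (sgn R b) => e k4.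
have M0 : 1 + m%:R != 0 :> R by rewrite nat1r pnatr_eq0.
have N0 : 2 + m%:R != 0 :> R by rewrite -natrD pnatr_eq0.
have NM : m.+2%:R - 1 = m.+1%:R :> R by rewrite -[m.+2%:R]natr1 addrK.
case: k k4 => [|[|[|[|k]]]]//= _.
- rewrite (range_spike0 _ ord0) /X1; congr [set _].
  rewrite vec_of_pt subSS subn0; apply: eq_pt => [|i].
    by rewrite nth_cat size_nseq ltnn subnn /= ?mulr1 ?mulNr.
  rewrite nth_cat size_nseq nth_nseq ltn_ord NM /base mul0r.
  by field; rewrite ?M0 ?N0.
- rewrite (range_spike0 _ ord0) /X2; congr [set _].
  rewrite vec_of_pt subSS subn0; apply: eq_pt => [|i].
    by rewrite nth_cat size_nseq ltnn subnn /= ?mulr1 ?mulNr.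
  rewrite nth_cat size_nseq nth_nseq ltn_ord NM /base mul0r.
  by field; rewrite ?M0 ?N0.
- rewrite -(orbitP'_spike _ _ ord0) /X3; congr (orbitP' _).
  rewrite vec_of_pt !subSS subn0 NM /=; apply: eq_pt => [|[[|i] lt_i_m]].
  + by rewrite nth_cat size_nseq ltnn subnn /= ?mulr1 ?mulNr.
  + by rewrite /base -val_eqE /=; field.
  + rewrite /base -val_eqE /= nth_cat size_nseq nth_nseq -ltnS lt_i_m.
    by field.
- rewrite -(orbitP'_spike _ _ ord_max) /X4; congr (orbitP' _).
  rewrite vec_of_pt !subSS subn0 NM; apply: eq_pt => [|i].
  + by rewrite nth_cat size_nseq ltnNge leqnSn /= subSnn /= mulNr.
  + rewrite nth_cat size_nseq nth_nseq /base -val_eqE /=.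
    have := ltn_ord i; rewrite ltnS leq_eqVlt => /orP[/eqP ->|im].
      rewrite ltnn subnn eqxx /=.
      by field; rewrite ?M0 ?N0.
    rewrite im (ltn_eqF im) /=; by field; rewrite ?M0 ?N0.
Qed.

(** * Distances from the families to the Johnson graph *)

Definition xpt (R : realType) (m : nat) (c : code) (i : 'I_m) : 'rV[R]_m.+1 :=
  spike (sgn R c.2 * tau R m.+1 c.1) (excess R c.1) i.
Arguments xpt : clear implicits.
Arguments xpt R {m} c i.

Lemma sgn_sq (R : realType) (b : bool) : sgn R b ^+ 2 = 1.
Proof. by case: b; rewrite /sgn ?sqrrN expr1n. Qed.

Lemma valid_lt4 (n : nat) (c : code) : valid n c -> (c.1 < 4)%N.
Proof. by case: c => -[|[|[|[|k]]]] b. Qed.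

Lemma Xs_xpt (R : realType) (m : nat) (c : code) :
  (4 <= m)%N -> valid m.+1 c -> Xs R m.+1 c = range (@xpt R m c).
Proof. by move=> m4 /valid_lt4; exact: Xs_range. Qed.

Lemma sq24_mul (R : realType) (m : nat) (x y : 'rV[R]_m.+1) : (0 < m)%N ->
  m%:R * sqd x y = 2 * m%:R \/ m%:R * sqd x y = 4 * m%:R <-> sq24 x y.
Proof.
move=> m0; have M0 : m%:R != 0 :> R by rewrite pnatr_eq0 -lt0n.
rewrite /sq24; split => -[h|h]; [left|right|left|right];
  by [rewrite h mulrC | apply: (mulfI M0); rewrite h mulrC].
Qed.

Lemma sqd_xpt_jvec (R : realType) (m : nat) (c : code) (i : 'I_m)
    (A : {set 'I_m}) : valid m.+1 c -> #|A| = 2%N ->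
  m%:R * sqd (xpt R c i) (jvec R A) =
  q R m.+1 c.1 + 2 * (m%:R - 2) + excess R c.1 ^+ 2 * (m%:R - 1)
  + 4 * excess R c.1 - 2 * excess R c.1 * m%:R * (i \in A)%:R.
Proof.
by move=> vc A2; rewrite sqd_spike_jvec// exprMn sgn_sq mul1r tau_sq.
Qed.

(** Substituting [q] and [excess], the squared distance is always 2 for [X1] and always 4 for [X2];
    for [X3] it is 2 if i lies in A and 4 otherwise, and for [X4] it is the other way round. *)
Lemma sq24_xpt_jvec (R : realType) (m : nat) (c : code) (i : 'I_m)
    (A : {set 'I_m}) : valid m.+1 c -> #|A| = 2%N ->
  sq24 (xpt R c i) (jvec R A).
Proof.
move=> vc A2; apply/sq24_mul; first exact: leq_ltn_trans (ltn_ord i).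
rewrite sqd_xpt_jvec// -natr1.
case: (i \in A); case: c vc => -[|[|[|[|k]]]] b //= _; rewrite -?natr1;
  by [left; ring | right; ring].
Qed.

Lemma jvec_hyperplane (R : realType) (m : nat) (A : {set 'I_m}) :
  #|A| = 2%N -> hyperplane2 R m.+1 (jvec R A).
Proof.
move=> A2; apply/hyperplane2_pt.
by rewrite add0r -natr_sum -A2 -sum1_card [in RHS]big_mkcond.
Qed.

Lemma sq24_neq (R : realType) (n : nat) (x y : 'rV[R]_n) : sq24 x y -> x <> y.
Proof. by move=> xy e; move: xy; rewrite e /sq24 sqdxx => -[]; lra. Qed.

Lemma Xs_sub (R : realType) (m : nat) (c : code) :
  (4 <= m)%N -> valid m.+1 c ->
  Xs R m.+1 c `<=` hyperplane2 R m.+1 `\` Jt R m.+1.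
Proof.
move=> m4 vc; rewrite Xs_xpt// => _ [i _ <-]; split.
  by apply: spike_hyperplane; exact: leq_trans m4.
rewrite Jt_jvec; last exact: leq_trans m4.
by move=> [A A2]; exact/sq24_neq/sq24_xpt_jvec.
Qed.

(** * Classification of the vectors that can be added *)

Lemma two_more (m : nat) (a b : 'I_m) : (4 <= m)%N ->
  exists k l, [/\ k != l, k \notin [set a; b]%SET & l \notin [set a; b]%SET].
Proof.
move=> m4.
have : (1 < #|~: [set a; b]%SET|)%N.
  have := cardsC [set a; b]%SET; rewrite card_ord cards2.
  by case: (a != b) => /=; lia.
by move=> /card_gt1P[k [l [kA lA kl]]]; exists k, l; rewrite !inE in kA lA *.
Qed.

(** For k other than a and b, f k + f a exceeds f k + f b, so these sums are s and s - 1. Hence all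
    such f k are equal and f a = f b + 1. As m >= 4 there are two such indices k and l, and f k + f
    l tells whether the common value is f a (then b is exceptional) or f b (then a is). *)
Lemma two_sums_step (R : realType) (m : nat) (f : 'I_m -> R) (s : R)
    (a b : 'I_m) : (4 <= m)%N ->
  (forall i j, i != j -> f i + f j = s \/ f i + f j = s - 1) ->
  a != b -> f b < f a ->
  exists (v c : R) (i : 'I_m), [/\ [\/ v = 0, v = 1 | v = -1] &
    forall j, f j = c + v * (j == i)%:R].
Proof.
move=> m4 fs ab fab.
have P k : k != a -> k != b -> f k + f a = s /\ f k + f b = s - 1.
  by move=> ka kb; case: (fs _ _ ka); case: (fs _ _ kb) => *; split; lra.
have [k [l [kl]]] := two_more a b m4.
rewrite !inE !negb_or => /andP[ka kb] /andP[la lb].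
have [Pa Pb] := P _ ka kb; have [Qa Qb] := P _ la lb.
have [fkl|fkl] := fs _ _ kl.
- exists (-1), (f k), b; split; first exact: Or33.
  move=> j; have [->|jb] := eqVneq j b; first by rewrite /=; lra.
  have [->|ja] := eqVneq j a; first by rewrite /=; lra.
  by have [] := P _ ja jb; rewrite /=; lra.
- exists 1, (f k), a; split; first exact: Or32.
  move=> j; have [->|ja] := eqVneq j a; first by rewrite /=; lra.
  have [->|jb] := eqVneq j b; first by rewrite /=; lra.
  by have [] := P _ ja jb; rewrite /=; lra.
Qed.

Lemma two_sums (R : realType) (m : nat) (f : 'I_m -> R) (s : R) : (4 <= m)%N ->
  (forall i j, i != j -> f i + f j = s \/ f i + f j = s - 1) ->
  exists (v c : R) (i : 'I_m), [/\ [\/ v = 0, v = 1 | v = -1] &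
    forall j, f j = c + v * (j == i)%:R].
Proof.
move=> m4 fs; pose a : 'I_m := Ordinal (leq_trans (isT : 0 < 4)%N m4).
have [/forallP fa|] := boolP [forall b, f b == f a].
  exists 0, (f a), a; split; first exact: Or31.
  by move=> j; rewrite mul0r addr0; exact/eqP/fa.
rewrite negb_forall => /existsP[b fb].
have ab : a != b by apply: contraNneq fb => <-.
case: (ltgtP (f b) (f a)) fb => // fab _.
- by apply: (two_sums_step m4 fs _ fab).
- by apply: (two_sums_step m4 fs _ fab); rewrite eq_sym.
Qed.

(** Coordinate sum 2 leaves [base] as the only possible value of the constant c. *)
Lemma spike_base (R : realType) (m : nat) (z v c : R) (f : 'I_m -> R)
    (i : 'I_m) : hyperplane2 R m.+1 (pt z f) ->
  (forall j, f j = c + v * (j == i)%:R) -> pt z f = spike (- z) v i.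
Proof.
move=> /hyperplane2_pt + fE.
have m0 : m%:R != 0 :> R.
  by rewrite pnatr_eq0 -lt0n (leq_ltn_trans _ (ltn_ord i)).
under eq_bigr do rewrite fE.
rewrite big_split/= sum_delta sumr_const card_ord -[_ *+ m]mulr_natl => h.
apply: eq_pt => [|j]; first by rewrite opprK.
rewrite fE /base; congr (_ + _); apply: (mulIf m0).
by rewrite divfK//; lra.
Qed.

Lemma sq24_Xs (R : realType) (m : nat) (x : 'rV[R]_m.+1) : (4 <= m)%N ->
  hyperplane2 R m.+1 x ->
  (forall A : {set 'I_m}, #|A| = 2%N -> sq24 x (jvec R A)) ->
  exists2 c, valid m.+1 c & Xs R m.+1 c x.
Proof.
move=> m4 Hx xJ; have M4 : 4 <= m%:R :> R by rewrite ler_nat.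
pose z := x 0 ord_max; pose f i := x 0 (lift ord_max i).
(* The squared distance from x to the indicator of {i, j} is |x|^2 + 2 - 2 (f i + f j); it equals 2
   when the sum is |x|^2 / 2 and 4 when the sum is one less. *)
pose s := sqd x 0 / 2.
have sums i j : i != j -> f i + f j = s \/ f i + f j = s - 1.
  move=> ij; have A2 : #|[set i; j]%SET| = 2%N by rewrite cards2 ij.
  suff : sqd x (jvec R [set i; j]%SET) = sqd x 0 + 2 - 2 * (f i + f j).
    by case: (xJ _ A2) => ->; rewrite /s; lra.
  have x0 : sqd x 0 = z ^+ 2 + \sum_k f k ^+ 2.
    rewrite /sqd (bigD1_ord ord_max)//= mxE subr0; congr (_ + _).
    by apply: eq_bigr => k _; rewrite mxE subr0.
  rewrite x0 [x]pt_eta sqd_pt subr0 -/z -addrA -addrA; congr (_ + _).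
  have iA (k : 'I_m) : (k \in [set i; j]%SET)%:R =
      1 * (k == i)%:R + (k == j)%:R :> R.
    rewrite !inE mul1r; have [->|] := eqVneq k i; last by rewrite add0r.
    by rewrite (negbTE ij) addr0.
  have sA : \sum_(k < m) (k \in [set i; j]%SET)%:R = 2 :> R.
    by rewrite -natr_sum -A2 -sum1_card [in RHS]big_mkcond.
  have -> : f i + f j = \sum_(k < m) f k * (k \in [set i; j]%SET)%:R.
    under eq_bigr do rewrite iA mulrDr mul1r.
    by rewrite big_split/= !sum_delta.
  rewrite -[X in _ + (X - _)]sA mulr_sumr -sumrB -big_split/=.
  apply: eq_bigr => k _; rewrite -/(f k); case: (_ \in _) => /=; ring.
have [v [c [i [v3 fE]]]] := two_sums m4 sums.
have xE : x = spike (- z) v i.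
  rewrite [LHS]pt_eta; apply: spike_base fE.
  by rewrite -pt_eta.
(* One pair containing the exceptional index and one avoiding it suffice to determine n z^2. *)
have [j [l [jl]]] := two_more i i m4.
rewrite !inE !orbb => ji li.
have cA1 : #|[set i; j]%SET| = 2%N by rewrite cards2 eq_sym ji.
have cA2 : #|[set j; l]%SET| = 2%N by rewrite cards2 jl.
have m0 : (0 < m)%N by exact: leq_trans m4.
have := sqd_spike_jvec (- z) v i cA1; have := sqd_spike_jvec (- z) v i cA2.
have /(sq24_mul _ _ m0) := xJ _ cA1; have /(sq24_mul _ _ m0) := xJ _ cA2.
rewrite -xE !inE eqxx !(eq_sym i) (negbTE ji) (negbTE li) /= mulr0 mulr1 subr0.
have Nz0 : 0 <= m.+1%:R * (- z) ^+ 2 by rewrite mulr_ge0 ?sqr_ge0.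
move=> h2 h1 e2 e1; rewrite {}e1 in h1; rewrite {}e2 in h2.
suff [k vk [vE qE]] : exists2 k, valid m.+1 (k, false) &
    v = excess R k /\ m.+1%:R * (- z) ^+ 2 = q R m.+1 k.
  have vkb b : valid m.+1 (k, b) by [].
  move: (tau_sq R (isT : 0 < m.+1)%N vk); rewrite /= -qE.
  move/(mulfI _); rewrite pnatr_eq0 => /(_ isT)/eqP.
  rewrite eq_sym eqf_sqr => /orP[]/eqP zt;
    [exists (k, false)|exists (k, true)] => //;
    rewrite Xs_xpt//; exists i => //; rewrite xE zt vE /xpt /=.
    by rewrite mul1r.
  by rewrite mulN1r.
move: h1 h2 Nz0; rewrite -!natr1; set Z := (_ * _ ^+ 2).
case: v3 => {xE fE}-> h1 h2 Z0.
(* For v = 0, squared distance 2 gives [X1] and 4 gives [X2]. For v = 1 and v = -1, nonnegativity of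
   n z^2 leaves one solution each. *)
- case: h2 => h2; [exists 0%N => //|exists 1%N => //]; split=> //=;
    rewrite -?natr1; lra.
- by exists 2%N => //; split=> //=; rewrite -natr1; lra.
(* Here n z^2 = 10 - n, so nonnegativity also yields the bound under which [X4] is present. *)
- have m10 : (m.+1 <= 10)%N by rewrite -(ler_nat R) -natr1; lra.
  by exists 3%N => //; split=> //=; rewrite -natr1; lra.
Qed.

(** * Compatibility of pairs of families *)

(* (n, k, l, o): for this n the sets X_(k+1) and X_(l+1) are compatible, with
   opposite signs if o is true and equal signs if o is false. *)
Definition edges : seq (nat * nat * nat * bool) :=
  [:: (5, 0, 0, true); (6, 0, 3, true); (7, 3, 3, true); (8, 1, 3, false);
      (9, 0, 0, true); (9, 0, 2, true); (9, 0, 3, true); (9, 2, 3, false);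
      (17, 0, 1, true)]%N.

(** [edges] stores the smaller index first. Changing both signs preserves all distances, so only the
    exclusive or of the signs enters. *)
Definition adj (n : nat) (c d : code) : bool :=
  (n, minn c.1 d.1, maxn c.1 d.1, c.2 (+) d.2) \in edges.

(* n.-1 times the squared distance between points of X_(k+1) and X_(l+1), where
   o tells whether the signs are opposite, e whether the exceptional positions
   coincide, and u = sqrt (q k * q l). *)
Definition dpoly (R : realType) (n k l : nat) (o e : bool) (u : R) : R :=
  q R n k + q R n l - 2 * sgn R o * u +
  ((n%:R - 1) * (excess R k ^+ 2 + excess R l ^+ 2
                 - 2 * excess R k * excess R l * e%:R)
   - (excess R k - excess R l) ^+ 2).

Lemma sqd_xpt (R : realType) (m : nat) (c d : code) :
  valid m.+1 c -> valid m.+1 d ->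
  exists2 u : R, 0 <= u /\ u ^+ 2 = q R m.+1 c.1 * q R m.+1 d.1 &
  forall i j : 'I_m, m%:R * sqd (xpt R c i) (xpt R d j) =
    dpoly m.+1 c.1 d.1 (c.2 (+) d.2) (i == j) u.
Proof.
move=> vc vd; have n0 : (0 < m.+1)%N by [].
(* Up to sign, u is n times the product of the two last coordinates; by [tau_sq] its square is the
   product of the two values of [q]. *)
exists (m.+1%:R * (tau R m.+1 c.1 * tau R m.+1 d.1)); first split.
- by rewrite !mulr_ge0 ?tau_ge0.
- rewrite -!(tau_sq R n0)//; ring.
move=> i j; rewrite sqd_spike sqrrB !exprMn !sgn_sq !mul1r.
rewrite /dpoly -!(tau_sq R n0)// -natr1 addrK.
have -> : sgn R (c.2 (+) d.2) = sgn R c.2 * sgn R d.2.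
  by case: c.2; case: d.2; rewrite /= /sgn ?mulN1r ?mul1r ?opprK.
by ring.
Qed.

(** The conditions for e true and e false are linear in n and u. Most cases are contradictory; in
    the others u becomes a constant or affine in n, and its square then determines n. The value 0 is
    allowed because points of two families may coincide. *)
Lemma dpoly_edges (R : realType) (n k l : nat) (o : bool) (u : R) :
  (5 <= n)%N -> (k <= l < 4)%N -> (l = 3 -> n <= 10)%N -> (k = l -> o) ->
  0 <= u -> u ^+ 2 = q R n k * q R n l ->
  (forall e, [\/ dpoly n k l o e u = 0, dpoly n k l o e u = 2 * (n%:R - 1)
               | dpoly n k l o e u = 4 * (n%:R - 1)]) ->
  (n, k, l, o) \in edges \/ [/\ n = 10%N, k = 3%N & l = 3%N].
Proof.
move=> n5 kl n10 klo u0 uu D.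
have N5 : 5 <= n%:R :> R by rewrite ler_nat.
have natE a : n%:R = a%:R :> R -> n = a by move/eqP; rewrite eqr_nat => /eqP.
(* The quadratics met below have roots a and b = 1, and n >= 5 discards b. *)
have fac a b : b%:R < 5 :> R ->
    n%:R ^+ 2 - (a%:R + b%:R) * n%:R + a%:R * b%:R = 0 :> R -> n = a.
  move=> b5 h; apply: natE; have : (n%:R - a%:R) * (n%:R - b%:R) = 0 :> R.
    by rewrite -h; ring.
  by move/eqP; rewrite mulf_eq0 !subr_eq0 => /orP[] /eqP //; lra.
have N10 : l = 3%N -> n%:R <= 10 :> R by move=> l3; rewrite ler_nat n10.
have Dt := D true; have Df := D false; move: {D} Dt Df uu klo N10.
rewrite /dpoly /sgn; case: k l kl {n10} => [|[|[|[|k]]]] [|[|[|[|l]]]];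
  rewrite ?andbF//= => _; case: o => Dt Df uu klo N10;
  try by have := klo erefl.
all: rewrite /= in Dt Df; case: Dt => Dt; case: Df => Df.
all: try by exfalso; clear natE fac klo; lra.
all: try by exfalso; clear natE fac klo; nra.
- have uE : u = 4 by clear natE fac klo; nra.
  by left; rewrite (natE 9%N); [|lra].
- have uE : u = 4 by clear natE fac klo; nra.
  by left; rewrite (natE 5%N); [|lra].
- have uE : u = n%:R - 5 by lra.
  by left; rewrite (fac 17%N 1%N); [|lra|rewrite uE in uu; lra].
- have uE : u = n%:R - 3 by lra.
  by left; rewrite (fac 9%N 1%N); [|lra|rewrite uE in uu; lra].
- have uE : u = n%:R - 7 by lra.
  by left; rewrite (fac 9%N 1%N); [|lra|rewrite uE in uu; lra].
- have uE : u = 2 * n%:R - 8 by lra.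
  by left; rewrite (fac 6%N 1%N); [|lra|rewrite uE in uu; lra].
(* [X2] and [X4] with opposite signs: the roots are 29/3, not an integer, and 1. *)
- have uE : u = n%:R - 7 by lra.
  have : (3 * n%:R - 29) * (n%:R - 1) = 0 :> R by rewrite uE in uu; lra.
  move/eqP; rewrite mulf_eq0 !subr_eq0 -natrM eqr_nat => /orP[|/eqP]; last lra.
  by move/eqP; lia.
- have uE : u = 6 by lra.
  by left; rewrite (fac 8%N 1%N); [|lra|rewrite uE in uu; lra].
- have uE : u = 3 by lra.
  by left; rewrite (fac 9%N 1%N); [|lra|rewrite uE in uu; lra].
(* Points of the two [X4] sets with equal positions coincide here, which forces n = 10, where the
   two sets are the same. *)
- have {}N10 := N10 erefl; have uE : u = 10 - n%:R by clear natE fac klo; nra.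
  by right; rewrite (natE 10%N); [|lra].
- have {}N10 := N10 erefl; have uE : u = 10 - n%:R by clear natE fac klo; nra.
  by left; rewrite (natE 7%N); [|lra].
Qed.

(** For every listed edge the product of the two values of [q] is a perfect square, so u is an
    explicit natural number and the distances can be evaluated. *)
Lemma edges_dpoly (R : realType) (n k l : nat) (o e : bool) (u : R) :
  (n, k, l, o) \in edges -> 0 <= u -> u ^+ 2 = q R n k * q R n l ->
  dpoly n k l o e u = 2 * (n%:R - 1) \/ dpoly n k l o e u = 4 * (n%:R - 1).
Proof.
move=> nE u0 uu.
have uE a : q R n k * q R n l = a%:R ^+ 2 -> u = a%:R.
  rewrite -uu => /eqP; rewrite eqf_sqr => /orP[] /eqP // ua.
  have := ler0n R a; lra.
move: nE uE; rewrite {uu} !inE /dpoly /sgn => /or4P[|||/or4P[|||/or3P[]]];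
  move=> /eqP[-> -> -> ->] /= uE.
- by rewrite (uE 4%N); [right|]; ring.
- by rewrite (uE 4%N); [right|]; ring.
- by rewrite (uE 3%N); [case: e => /=; [left|right]|]; ring.
- by rewrite (uE 6%N); [left|]; ring.
- by rewrite (uE 4%N); [left|]; ring.
- by rewrite (uE 6%N); [right|]; ring.
- by rewrite (uE 2%N); [left|]; ring.
- by rewrite (uE 3%N); [case: e => /=; [right|left]|]; ring.
- by rewrite (uE 12%N); [right|]; ring.
Qed.

Lemma adj_sym (n : nat) (c d : code) : adj n c d = adj n d c.
Proof. by rewrite /adj minnC maxnC addbC. Qed.

Lemma sq24C (R : realType) (n : nat) (x y : 'rV[R]_n) : sq24 x y -> sq24 y x.
Proof. by rewrite /sq24 sqdC. Qed.

Lemma adj_sq24 (R : realType) (m : nat) (c d : code) (i j : 'I_m) :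
  valid m.+1 c -> valid m.+1 d -> adj m.+1 c d ->
  sq24 (xpt R c i) (xpt R d j).
Proof.
wlog cd : c d i j / (c.1 <= d.1)%N.
  move=> W vc vd a; case: (leqP c.1 d.1) => [|/ltnW] cd; first exact: W.
  by apply: sq24C; apply: W => //; rewrite adj_sym.
move=> vc vd; rewrite /adj (minn_idPl cd) (maxn_idPr cd) => nE.
apply/sq24_mul; first exact: leq_ltn_trans (ltn_ord i).
have [u [u0 uu] ->] := sqd_xpt R vc vd.
by have := edges_dpoly (i == j) nE u0 uu; rewrite -[m.+1%:R]natr1 addrK.
Qed.

Lemma compat_adj (R : realType) (m : nat) (c d : code) :
  (4 <= m)%N -> valid m.+1 c -> valid m.+1 d -> c != d ->
  (forall i j : 'I_m, xpt R c i <> xpt R d j -> sq24 (xpt R c i) (xpt R d j)) ->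
  adj m.+1 c d \/ [/\ m.+1 = 10, c.1 = 3 & d.1 = 3]%N.
Proof.
move=> m4; have m0 : (0 < m)%N by exact: leq_trans m4.
wlog cd : c d / (c.1 <= d.1)%N.
  move=> W vc vd ncd P; case: (leqP c.1 d.1) => [|/ltnW] cd; first exact: W.
  rewrite adj_sym; have [||a|[? ? ?]] := W d c cd vd vc; last by right.
  - by rewrite eq_sym.
  - by move=> i j; rewrite /sq24 sqdC => xy; apply: P => /esym.
  - by left.
move=> vc vd ncd P; rewrite /adj (minn_idPl cd) (maxn_idPr cd).
have [u [u0 uu] D] := sqd_xpt R vc vd.
apply: (@dpoly_edges R _ _ _ _ u) => //.
- by rewrite cd (valid_lt4 vd).
- by move: vd => /orP[|/andP[]//] + d3; rewrite d3.
- move=> k; apply: contraNT ncd; case: (c) (d) k => [k b] [l b'] /= -> /negP.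
  by case: b; case: b'.
(* Both values of e are realized, by equal positions or by the two distinct positions 0 and 1. *)
move=> e; pose i : 'I_m := Ordinal m0.
pose j : 'I_m := Ordinal (leq_trans (isT : 1 < 4)%N m4).
have -> : e = (i == (if e then i else j)) by case: e => //; rewrite eqxx.
rewrite -D -[m.+1%:R]natr1 addrK; set j' := if e then i else j.
have [xy|xy] := pselect (xpt R c i = xpt R d j').
  by apply: Or31; rewrite xy sqdxx mulr0.
by have /(sq24_mul _ _ m0)[] := P i j' xy; [exact: Or32|exact: Or33].
Qed.

(** [X1] and [X2] are singletons; distinct points of [X3], or of [X4], are at squared distance 2. *)
Lemma xpt_self (R : realType) (m : nat) (c : code) (i j : 'I_m) :
  (c.1 < 4)%N -> xpt R c i <> xpt R c j -> sq24 (xpt R c i) (xpt R c j).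
Proof.
case: c => -[|[|[|[|k]]]] b //= _ xy.
- by case: xy; apply: eq_pt => // k; rewrite !mul0r.
- by case: xy; apply: eq_pt => // k; rewrite !mul0r.
- have ij : i != j by apply: contra_notN xy => /eqP ->.
  apply/sq24_mul; first exact: leq_ltn_trans (ltn_ord i).
  by left; rewrite sqd_spike (negbTE ij) /=; ring.
- have ij : i != j by apply: contra_notN xy => /eqP ->.
  apply/sq24_mul; first exact: leq_ltn_trans (ltn_ord i).
  by left; rewrite sqd_spike (negbTE ij) /=; ring.
Qed.

(** The radicand 10 n - n^2 vanishes at n = 10, which makes the sign immaterial. *)
Lemma Xs10 (R : realType) (b b' : bool) : Xs R 10 (3, b)%N = Xs R 10 (3, b')%N.
Proof.
rewrite !Xs_xpt//; suff e : @xpt R 9 (3, b)%N =1 @xpt R 9 (3, b')%N.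
  by apply/seteqP; split => _ [i _ <-]; exists i.
move=> i; rewrite /xpt /=.
have -> : 10 * 10%:R - 10%:R ^+ 2 = 0 :> R by ring.
by rewrite sqrtr0 mul0r !mulr0.
Qed.

(** * Counting the vectors of a combination *)

Definition xseq (R : realType) (m : nat) (c : code) : seq 'rV[R]_m.+1 :=
  undup (map (@xpt R m c) (enum 'I_m)).

Lemma mem_xseq (R : realType) (m : nat) (c : code) (x : 'rV[R]_m.+1) :
  reflect (exists i : 'I_m, x = xpt R c i) (x \in xseq R m c).
Proof.
rewrite mem_undup; apply: (iffP mapP) => [[i _ ->]|[i ->]]; first by exists i.
by exists i; rewrite ?mem_enum.
Qed.

(** [undup] merges the m equal points of [X1] or [X2]; in [X3] and [X4] different positions give
    points at positive distance. *)
Lemma size_xseq (R : realType) (m : nat) (c : code) :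
  (0 < m)%N -> (c.1 < 4)%N ->
  size (xseq R m c) = (if (c.1 < 2)%N then 1 else m)%N.
Proof.
move=> m0 c4; case: ifP => c2.
  pose i0 : 'I_m := Ordinal m0.
  have e i : xpt R c i = xpt R c i0.
    apply: eq_pt => // k; case: c c2 {c4} => -[|[|]]//= b _;
    by rewrite !mul0r.
  apply/eqP; rewrite eqn_leq; apply/andP; split.
    apply: (@uniq_leq_size _ _ [:: xpt R c i0]); first exact: undup_uniq.
    by move=> x /mem_xseq[i ->]; rewrite e inE.
  rewrite -has_predT; apply/hasP; exists (xpt R c i0) => //.
  by apply/mem_xseq; exists i0.
have inj : injective (@xpt R m c).
  move=> i j ij; apply/eqP; apply/negPn/negP => nij.
  have := sqd_spike (sgn R c.2 * tau R m.+1 c.1) (excess R c.1)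
            (sgn R c.2 * tau R m.+1 c.1) (excess R c.1) i j.
  rewrite -/(xpt R c i) -/(xpt R c j) ij sqdxx (negbTE nij) /=.
  have M0 : 0 < m%:R :> R by rewrite ltr0n.
  rewrite !subrr expr0n /= !mulr0 add0r !subr0.
  by case: c c2 c4 {ij} => -[|[|[|[|]]]]//= b _ _ h; lra.
rewrite /xseq undup_id; first by rewrite size_map size_enum_ord.
by rewrite map_inj_uniq ?enum_uniq.
Qed.

Lemma uniq_flatten_map (T U : eqType) (f : T -> seq U) (l : seq T) :
  uniq l -> (forall c, uniq (f c)) ->
  (forall c d, c \in l -> d \in l -> c != d ->
    forall x y, x \in f c -> y \in f d -> x <> y) ->
  uniq (flatten (map f l)).
Proof.
move=> + fu; elim: l => //= c l IH /andP[cl ul] fd.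
rewrite cat_uniq fu IH//=; last first.
  by move=> c' d' c'l d'l; apply: fd; rewrite inE ?c'l ?d'l orbT.
rewrite andbT; apply/hasPn => y /flatten_mapP[d dl yd]; apply/negP => yc.
apply: (fd c d _ _ _ y y) => //; rewrite ?inE ?eqxx ?dl ?orbT//.
by apply: contraNneq cl => ->.
Qed.

Definition clique (n : nat) (l : seq code) : Prop :=
  uniq l /\ {in l &, forall c d, c != d -> adj n c d}.

(** Mere inclusion of [F] in the coded family covers the sub-unions, and a one-element [l] covers
    the simultaneous addition of a single family. *)
Lemma clique_two_distance (R : realType) (m : nat) (l : seq code)
    (F : set (set 'rV[R]_m.+1)) :
  (4 <= m)%N -> all (valid m.+1) l -> clique m.+1 l ->
  F `<=` Xs R m.+1 @` [set` l] ->
  two_distance_set (Jt R m.+1 `|` \bigcup_(A in F) A).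
Proof.
move=> m4 /allP vl [_ al] Fl.
have Fx x : (\bigcup_(A in F) A) x -> exists c i, c \in l /\ x = xpt R c i.
  move=> [A /Fl [c cl <-]]; rewrite Xs_xpt ?vl// => -[i _ <-].
  by exists c, i.
apply/two_distance_Jt => //.
  apply: (@sub_finite_set _ _ [set` flatten (map (xseq R m) l)]).
    move=> x /Fx[c [i [cl ->]]] /=.
    by apply/flatten_mapP; exists c => //; apply/mem_xseq; exists i.
  exact: finite_seq.
split=> [A _ A2 /Fx[c [i [cl ->]]] _|_ _ /Fx[c [i [cl ->]]] /Fx[d [j [dl ->]]]].
  by apply: sq24_xpt_jvec => //; exact: vl.
have [->|cd] := eqVneq c d; first exact/xpt_self/valid_lt4/vl.
by move=> _; apply: adj_sq24; rewrite ?vl ?al.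
Qed.

(** Adjacency forces squared distance 2 or 4, hence disjointness, also from the Johnson graph;
    concatenating the lists of points gives no repetition. *)
Lemma card_Jt_clique (R : realType) (m : nat) (l : seq code) :
  (4 <= m)%N -> all (valid m.+1) l -> clique m.+1 l ->
  ((Jt R m.+1 `|` \bigcup_(A in Xs R m.+1 @` [set` l]) A) #=
   `I_('C(m, 2) + sumn [seq if (c.1 < 2)%N then 1 else m | c <- l]))%card.
Proof.
move=> m4 /allP vl [ul al].
have m0 : (0 < m)%N by exact: leq_trans m4.
pose J2 := [set A : {set 'I_m} | #|A| == 2%N]%SET.
pose s := map (jvec R) (enum J2) ++ flatten (map (xseq R m) l).
have us : uniq s.
  rewrite cat_uniq map_inj_uniq ?enum_uniq; last exact: jvec_inj.
  rewrite uniq_flatten_map ?andbT//=.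
  - apply/hasPn => _ /flatten_mapP[c cl /mem_xseq[i ->]].
    apply/negP => /mapP[A]; rewrite mem_enum inE => /eqP A2.
    by apply: sq24_neq; apply: sq24_xpt_jvec => //; exact: vl.
  - by move=> c; exact: undup_uniq.
  - move=> c d cl dl cd _ _ /mem_xseq[i ->] /mem_xseq[j ->].
    by apply: sq24_neq; apply: adj_sq24; rewrite ?vl ?al.
have -> : ('C(m, 2) + sumn [seq if (c.1 < 2)%N then 1 else m | c <- l])%N =
    size s.
  rewrite size_cat size_map -cardE card_draws card_ord size_flatten /shape.
  rewrite -map_comp; congr (_ + sumn _)%N; apply/eq_in_map => c cl /=.
  by rewrite size_xseq// (valid_lt4 (vl _ cl)).
suff -> : Jt R m.+1 `|` \bigcup_(A in Xs R m.+1 @` [set` l]) A = [set` s].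
  exact: card_uniq_seq.
rewrite Jt_jvec; last exact: leq_trans m4.
apply/seteqP; split => x /=; rewrite mem_cat.
  move=> [[A A2 ->]|[_ [c cl <-]]].
    by rewrite map_f// mem_enum inE A2.
  rewrite Xs_xpt ?vl// => -[i _ <-]; apply/orP; right.
  by apply/flatten_mapP; exists c => //; apply/mem_xseq; exists i.
move=> /orP[/mapP[A]|/flatten_mapP[c cl /mem_xseq[i ->]]].
  by rewrite mem_enum inE => /eqP A2 ->; left; exists A.
right; exists (Xs R m.+1 c); first by exists c.
by rewrite Xs_xpt ?vl//; exists i.
Qed.

(** * The finite search for cliques *)

(* In (n, l, k), k counts the vectors of Jt and of the sets coded by l. *)
Definition cliques : seq (nat * seq code * nat) :=
  let p k := (k, false) in let m k := (k, true) in
  [:: (5, [:: p 0; m 0], 8);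
      (6, [:: p 0; m 3], 16); (6, [:: m 0; p 3], 16);
      (7, [:: p 3; m 3], 27);
      (8, [:: p 1; p 3], 29); (8, [:: m 1; m 3], 29);
      (9, [:: p 0; m 0], 30);
      (9, [:: p 0; m 2; m 3], 45); (9, [:: m 0; p 2; p 3], 45);
      (17, [:: p 0; m 1], 122); (17, [:: m 0; p 1], 122)]%N.

Lemma image_seq2 (T U : eqType) (f : T -> U) (c d : T) :
  f @` [set` [:: c; d]] = [set f c; f d].
Proof.
apply/seteqP; split => [_ [a /= + <-]|_ [] -> /=].
- by rewrite !inE => /orP[] /eqP ->; [left|right].
- by exists c; rewrite //= !inE eqxx.
- by exists d; rewrite //= !inE eqxx orbT.
Qed.

Lemma image_seq3 (T U : eqType) (f : T -> U) (c d e : T) :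
  f @` [set` [:: c; d; e]] = [set f c; f d; f e].
Proof.
apply/seteqP; split => [_ [a /= + <-]|_ [[] ->|->] /=].
- by rewrite !inE => /or3P[] /eqP ->; [left; left|left; right|right].
- by exists c; rewrite //= !inE eqxx.
- by exists d; rewrite //= !inE eqxx orbT.
- by exists e; rewrite //= !inE eqxx !orbT.
Qed.

Lemma maximal_combinationsP (R : realType) (n : nat)
    (L : set (set 'rV[R]_n) * nat) :
  maximal_combinations R n L <->
  exists l k, (n, l, k) \in cliques /\ L = (Xs R n @` [set` l], k).
Proof.
split.
- case: n L =>
    [|[|[|[|[|[|[|[|[|[|[|[|[|[|[|[|[|[|n]]]]]]]]]]]]]]]]]] L;
    rewrite /maximal_combinations //.
  + move=> ->; exists [:: (0, false); (0, true)]%N, 8%N.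
    by rewrite image_seq2.
  + case=> ->; [exists [:: (0, false); (3, true)]%N, 16%N
               |exists [:: (0, true); (3, false)]%N, 16%N];
    by rewrite image_seq2.
  + by move=> ->; exists [:: (3, false); (3, true)]%N, 27%N; rewrite image_seq2.
  + case=> ->; [exists [:: (1, false); (3, false)]%N, 29%N
               |exists [:: (1, true); (3, true)]%N, 29%N];
    by rewrite image_seq2.
  + case=> [[]|] ->; [exists [:: (0, false); (0, true)]%N, 30%N
               |exists [:: (0, false); (2, true); (3, true)]%N, 45%N
               |exists [:: (0, true); (2, false); (3, false)]%N, 45%N];
    by rewrite ?image_seq2 ?image_seq3.
  + case=> ->; [exists [:: (0, false); (1, true)]%N, 122%N
               |exists [:: (0, true); (1, false)]%N, 122%N];
    by rewrite image_seq2.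
- case=> l [k [+ ->]]; rewrite !inE /=.
  move=> /or4P[|||/or4P[|||/or4P[|||/orP[]]]] /eqP[-> -> ->];
    rewrite ?image_seq2 ?image_seq3 /maximal_combinations //=.
  + by left.
  + by right.
  + by left.
  + by right.
  + by left; left.
  + by left; right.
  + by right.
  + by left.
  + by right.
Qed.

Lemma cliquesP (n k : nat) (l : seq code) : (n, l, k) \in cliques ->
  [/\ all (valid n) l, clique n l &
      k = 'C(n.-1, 2) + sumn [seq if (c.1 < 2)%N then 1 else n.-1 | c <- l]]%N.
Proof.
have : all (fun t : nat * seq code * nat => let: (n, l, k) := t in
    [&& all (valid n) l, uniq l,
        all (fun c => all (fun d => (c != d) ==> adj n c d) l) l &
        k == 'C(n.-1, 2) +
             sumn [seq if (c.1 < 2)%N then 1 else n.-1 | c <- l]])%N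
    cliques.
  by vm_compute.
move=> /allP H /H /and4P[vl ul al /eqP kE]; split=> //; split=> // c d cl dl cd.
by have /allP/(_ _ cl)/allP/(_ _ dl)/implyP/(_ cd) := al.
Qed.

Definition codes : seq code :=
  [seq (k, b) | k <- iota 0 4, b <- [:: false; true]].

Fixpoint bitseqs (n : nat) : seq bitseq :=
  if n is n'.+1 then
    map (cons false) (bitseqs n') ++ map (cons true) (bitseqs n')
  else [:: [::]].

Lemma mem_bitseqs (s : bitseq) : s \in bitseqs (size s).
Proof.
by elim: s => [|[] s IH] //=; rewrite mem_cat map_f ?orbT.
Qed.

(** [P] is a subset of the eight codes, hence a bit mask of length 8. Only six values of n carry an
    edge, so computation can test every mask for each of them. *)
Lemma clique_sub (n : nat) (P : pred code) (c0 d0 : code) :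
  (forall c, P c -> (c.1 < 4)%N) ->
  (forall c d, P c -> P d -> c != d -> adj n c d) ->
  P c0 -> P d0 -> c0 != d0 ->
  exists l k, (n, l, k) \in cliques /\ forall c, P c -> c \in l.
Proof.
move=> P4 Padj Pc0 Pd0 cd0.
have nE : n \in [:: 5; 6; 7; 8; 9; 17]%N.
  have := Padj _ _ Pc0 Pd0 cd0.
  by rewrite /adj !inE => /or4P[|||/or4P[|||/or3P[]]] /eqP[->].
have Pcodes c : P c -> c \in codes.
  by case: c => -[|[|[|[|k]]]] [] /P4.
pose test n (bs : bitseq) := let s := mask bs codes in
  (1 < size s)%N && all (fun c => all (fun d => (c != d) ==> adj n c d) s) s ==>
  has (fun t => (t.1.1 == n) && all (mem t.1.2) s) cliques.
have : all (fun n => all (test n) (bitseqs 8)) [:: 5; 6; 7; 8; 9; 17]%N.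
  by vm_compute.
move=> /allP/(_ _ nE)/allP/(_ (map P codes) (mem_bitseqs (map P codes))).
rewrite /test -filter_mask; set b := (_ && _); have -> : b.
  apply/andP; split.
    apply: (@uniq_leq_size _ [:: c0; d0]); first by rewrite /= inE cd0.
    by move=> c; rewrite !inE mem_filter => /orP[] /eqP ->;
       rewrite ?Pc0 ?Pd0 Pcodes.
  apply/allP => c; rewrite mem_filter => /andP[Pc _].
  apply/allP => d; rewrite mem_filter => /andP[Pd _].
  by apply/implyP; exact: Padj.
rewrite implyTb => /hasP[[[n' l] k] nlk /andP[/eqP n'n /allP sub]].
exists l, k; split; first by rewrite -n'n.
by move=> c Pc; apply: sub; rewrite mem_filter Pc Pcodes.
Qed.

(** * From two-distance unions to cliques *)

Lemma Xs_compat (R : realType) (m : nat) (c d : code)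
    (S : set 'rV[R]_m.+1) : (4 <= m)%N -> valid m.+1 c -> valid m.+1 d ->
  Xs R m.+1 c `<=` S -> Xs R m.+1 d `<=` S ->
  finite_set S -> two_distance_set (Jt R m.+1 `|` S) ->
  forall i j : 'I_m, xpt R c i <> xpt R d j -> sq24 (xpt R c i) (xpt R d j).
Proof.
move=> m4 vc vd cS dS fS /(two_distance_Jt m4 fS)[_ PS] i j.
by apply: PS; [apply: cS|apply: dS]; rewrite Xs_xpt.
Qed.

Theorem mainTheorem4 (R : realType) (n : nat) (n_ge5 : (5 <= n)%N) :
  (* the ambient space contains all the sets, and the X_i avoid Jt *)
  (Jt R n `<=` hyperplane2 R n /\
   forall A, Xsets R n A -> A `<=` hyperplane2 R n `\` Jt R n) /\
  (* (1) *)
  ((forall x : 'rV[R]_n, (hyperplane2 R n `\` Jt R n) x ->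
      (two_distance_set (Jt R n `|` [set x]) <->
       exists2 A, Xsets R n A & A x)) /\
   (forall A, Xsets R n A -> two_distance_set (Jt R n `|` A))) /\
  (* (2) *)
  ((forall F : set (set 'rV[R]_n),
      F `<=` Xsets R n ->
      (exists A B, [/\ F A, F B & A <> B]) ->
      (two_distance_set (Jt R n `|` \bigcup_(A in F) A) <->
       exists2 L, maximal_combinations R n L & F `<=` L.1)) /\
   (forall L, maximal_combinations R n L ->
      (Jt R n `|` \bigcup_(A in L.1) A) #= `I_(L.2))%card).
Proof.
case: n n_ge5 => // m; rewrite ltnS => m4.
have Xsv c : valid m.+1 c -> Xsets R m.+1 (Xs R m.+1 c).
  by move=> vc; apply/XsetsP; exists c.
have single c : clique m.+1 [:: c].
  split=> // a b; rewrite !inE => /eqP -> /eqP ->.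
  by rewrite eqxx.
split; [split|split; [split|split]].
- rewrite Jt_jvec; last exact: leq_trans m4.
  by move=> _ [A A2 ->]; exact: jvec_hyperplane.
- by move=> A /XsetsP[c vc ->]; exact: Xs_sub.
- move=> x [Hx nJ]; rewrite Jt_jvec in nJ; last exact: leq_trans m4.
  have neq (A : {set 'I_m}) : #|A| = 2%N -> x <> jvec R A.
    by move=> A2 xA; apply: nJ; exists A.
  have fin : finite_set [set x] by exact: finite_set1.
  split.
  + move=> /(two_distance_Jt m4 fin)[xJ _].
    have [A A2|c vc xc] := sq24_Xs m4 Hx; first by apply: xJ => //; exact: neq.
    by exists (Xs R m.+1 c) => //; exact: Xsv.
  + move=> [A /XsetsP[c vc ->]]; rewrite Xs_xpt// => -[i _ xE].
    apply/two_distance_Jt => //; split=> [B y B2 -> _|_ _ -> ->] //.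
    by rewrite -xE; exact: sq24_xpt_jvec.
- move=> A /XsetsP[c vc ->]; rewrite -(bigcup_set1 id (Xs R m.+1 c)).
  apply: (clique_two_distance m4 _ (single c)); first by rewrite /= vc.
  by move=> _ ->; exists c; rewrite //= inE.
- move=> F FX [A [B [FA FB AB]]]; split; last first.
    move=> [L /maximal_combinationsP[l [k [/cliquesP[vl cl _] ->]]] /=].
    exact: clique_two_distance.
  move=> [fin td].
  set S := \bigcup_(C in F) C in fin td *.
  have finS : finite_set S.
    by move: fin; rewrite finite_setU => -[].
  have compat c d : valid m.+1 c -> valid m.+1 d ->
      F (Xs R m.+1 c) -> F (Xs R m.+1 d) -> c != d ->
      adj m.+1 c d \/ [/\ m.+1 = 10, c.1 = 3 & d.1 = 3]%N.
    move=> vc vd Fc Fd cd.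
    have cS : Xs R m.+1 c `<=` S by move=> x xc; exists (Xs R m.+1 c).
    have dS : Xs R m.+1 d `<=` S by move=> x xd; exists (Xs R m.+1 d).
    apply: (@compat_adj R) => //.
    exact: (Xs_compat m4 vc vd cS dS finS (conj fin td)).
  have /XsetsP[c0 vc0 AE] := FX _ FA; have /XsetsP[d0 vd0 BE] := FX _ FB.
  rewrite AE in FA AB; rewrite BE in FB AB.
  have cd0 : c0 != d0 by apply: contra_notN AB => /eqP ->.
  (* In the exceptional case n = 10 the two codes would denote the same set, against A <> B. *)
  have a0 : adj m.+1 c0 d0.
    have [//|[m10 c3 d3]] := compat _ _ vc0 vd0 FA FB cd0.
    case: AB; rewrite (surjective_pairing c0) (surjective_pairing d0) c3 d3.
    by case: m10 => ->; exact: Xs10.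
  (* No edge exists for n = 10, so one adjacent pair rules out the exceptional case for all
     pairs. *)
  have m10 : m.+1 <> 10%N by move=> m10; move: a0; rewrite /adj m10.
  pose P c := valid m.+1 c && `[< F (Xs R m.+1 c) >].
  have [||||l [k [lk Pl]]] := @clique_sub m.+1 P c0 d0 _ _ _ _ cd0.
  + by move=> c /andP[vc _]; exact: valid_lt4 vc.
  + move=> c d /andP[vc /asboolP Fc] /andP[vd /asboolP Fd] cd.
    by have [|[]] := compat _ _ vc vd Fc Fd cd.
  + by rewrite /P vc0; exact/asboolP.
  + by rewrite /P vd0; exact/asboolP.
  exists (Xs R m.+1 @` [set` l], k).
    by apply/maximal_combinationsP; exists l, k.
  move=> C FC; have /XsetsP[c vc CE] := FX _ FC.
  exists c => //; apply: Pl; rewrite /P vc -CE; exact/asboolP.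
- move=> L /maximal_combinationsP[l [k [/cliquesP[vl cl ->] ->]]] /=.
  exact: card_Jt_clique.
Qed.
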